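(* Fix an integer $n\ge 1$ and a real number $\epsilon>0$. Then there exist finitely many series of $\mathbb{Q}$-factorial toric singularities in $T^n$ such that an $n$-dimensional $\mathbb{Q}$-factorial toric singularity has minimal log-discrepancy greater than $\epsilon$ if and only if it belongs to at least one of these series. The same holds with ''greater than $\epsilon$'' replaced by ''greater than or equal to $\epsilon$''.
   Context: Let $T^n=\mathbb{R}^n/\mathbb{Z}^n$, identified with the set of points $(x_1,\dots,x_n)$ with $0\le x_i<1$, and let $e_1,\dots,e_n$ be the standard basis of $\mathbb{R}^n$. An $n$-dimensional $\mathbb{Q}$-factorial toric singularity is given by a rational simplicial cone in $\mathbb{R}^n$ together with a lattice; after a linear change of coordinates sending the primitive lattice points of the rays of the cone to $e_1,\dots,e_n$, the cone is the standard positive orthant and the lattice $L$ contains $\mathbb{Z}^n$ with finite index. Thus such a singularity is encoded by the finite subgroup $G=L/\mathbb{Z}^n\subset T^n$, which satisfies $G\cap (\mathbb{R}/\mathbb{Z})\cdot e_i=\{0\}$ for every $i$; conversely every finite subgroup $G\subset T^n$ with this property defines such a singularity (standard orthant, lattice $L=$ preimage of $G$ in $\mathbb{R}^n$). The minimal log-discrepancy of the singularity defined by $G$ is the minimum, over the nonzero elements of $G$, of the sum of coordinates $x_1+\dots+x_n$ of the element written with $0\le x_i<1$. A series of $\mathbb{Q}$-factorial toric singularities is a closed subgroup $V\subset T^n$ together with finitely many proper closed subgroups $V_i\subset V$ and, for each $i$, finitely many proper closed subgroups $V_{ij}\subset V_i$. A toric singularity belongs to this series if and only if it is defined by a finite subgroup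 $G\subset V$ such that $G\cap V_i\subset\bigcup_j V_{ij}$ for all $i$. *)

(* Defs.v *)
From HB Require Import structures.
From mathcomp Require Import all_boot all_order all_algebra.
From mathcomp Require Import all_classical all_reals all_analysis.
Set Implicit Arguments. Unset Strict Implicit. Unset Printing Implicit Defensive.
Import Order.TTheory GRing.Theory Num.Theory.
Import numFieldNormedType.Exports.
Local Open Scope classical_set_scope.
Local Open Scope ring_scope.

Section Torus.
Variables (R : realType) (n : nat).

Definition torus : set 'rV[R]_n := [set x | forall i, 0 <= x ord0 i < 1].

Definition fracv (x : 'rV[R]_n) : 'rV[R]_n :=
  \row_i (x ord0 i - (Num.floor (x ord0 i))%:~R).

Definition torus_subgroup (S : set 'rV[R]_n) : Prop :=
  [/\ S `<=` torus, S 0 & forall x y, S x -> S y -> S (fracv (x - y))].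

(* Closedness in the quotient topology of T^n = R^n / Z^n. *)
Definition torus_closed (S : set 'rV[R]_n) : Prop := closed (fracv @^-1` S).

Definition closed_subgroup (S : set 'rV[R]_n) : Prop :=
  torus_subgroup S /\ torus_closed S.

Definition axis_free (G : set 'rV[R]_n) : Prop :=
  forall (i : 'I_n) x, G x -> (forall j, j != i -> x ord0 j = 0) -> x = 0.

Definition toric_sing (G : set 'rV[R]_n) : Prop :=
  [/\ torus_subgroup G, finite_set G & axis_free G].

(* Minimal log-discrepancy: minimum over nonzero elements of the coordinate sum
   (an infimum over a finite set; +oo for the trivial group). *)
Definition mld (G : set 'rV[R]_n) : \bar R :=
  ereal_inf [set ((\sum_i x ord0 i)%:E) | x in G `\ 0].

Record tseries := TSeries {
  sV : set 'rV[R]_n;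
  sk : nat;
  sVi : nat -> set 'rV[R]_n;
  sm : nat -> nat;
  sVij : nat -> nat -> set 'rV[R]_n }.

Definition series_wf (s : tseries) : Prop :=
  [/\ closed_subgroup (sV s),
      forall i, (i < sk s)%N -> closed_subgroup (sVi s i) /\ sVi s i `<` sV s &
      forall i j, (i < sk s)%N -> (j < sm s i)%N ->
        closed_subgroup (sVij s i j) /\ sVij s i j `<` sVi s i].

Definition belongs (G : set 'rV[R]_n) (s : tseries) : Prop :=
  G `<=` sV s /\
  forall i, (i < sk s)%N ->
    G `&` sVi s i `<=` [set x | exists2 j, (j < sm s i)%N & sVij s i j x].

End Torus.

(* Main.v *)
Require Import Defs.
From HB Require Import structures.
From mathcomp Require Import all_boot all_order all_algebra.
From mathcomp Require Import all_classical all_reals all_analysis.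
From mathcomp Require Import ring lra zify.
Import Order.TTheory GRing.Theory Num.Theory.
Import numFieldNormedType.Exports.
Local Open Scope classical_set_scope.
Local Open Scope ring_scope.
Set Implicit Arguments.
Unset Strict Implicit.

(** The condition on the minimal log-discrepancy says that G avoids, in every coordinate
    subtorus, the points with positive coordinates and sum below (or at most) eps.  So it
    suffices to prove Lawrence's theorem: if every closed subgroup K that meets a set U
    meets it in a set with nonempty interior relative to K, then the finite subgroups
    avoiding U are covered by finitely many closed subgroups avoiding U.

    If K contains a ball around x0 inside U, let g be a high power of the sum of the
    1 + cos 2 pi x_i, a trigonometric polynomial concentrated at 0.  For a finite subgroup H
    of K on which no frequency of g vanishes unless it vanishes on K, orthogonality of
    characters makes the average of g(x - y) over x in H independent of y in K.  It is tiny
    for y = x0 when H avoids the ball, but summing it over a finite net of points y in K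
    gives something larger.  Hence H lies in the kernel, proper in K, of one of finitely many
    characters, and Noetherian induction on K (the annihilators in Z^n increase strictly)
    concludes. *)

(** * The cosine of period one *)

Section CosTau.
Variable R : realType.
Implicit Types (t a b r : R).

Definition ctau t : R := cos (t * (pi *+ 2)).

Lemma ctau0 : ctau 0 = 1.
Proof. by rewrite /ctau mul0r cos0. Qed.

Lemma ctauN t : ctau (- t) = ctau t.
Proof. by rewrite /ctau mulNr cosN. Qed.

Lemma ctau_le1 t : ctau t <= 1.
Proof. exact: cos_le1. Qed.

Lemma ctau_geN1 t : - 1 <= ctau t.
Proof. exact: cos_geN1. Qed.

Lemma ctauDint t k : k \is a Num.int -> ctau (t + k) = ctau t.
Proof.
move=> /intrP [z ->]; rewrite /ctau mulrDl.
have per (u : R) (j : nat) : cos (u + j%:R * (pi *+ 2)) = cos u.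
  elim: j => [|j IH]; first by rewrite mul0r addr0.
  by rewrite -addn1 natrD mulrDl mul1r addrA cosD2pi.
case: (intP z) => [|j|j]; first by rewrite mul0r addr0.
- by rewrite per.
- by rewrite -[LHS](per _ j.+1) mulrNz mulNr subrK.
Qed.

Lemma ctau_int k : k \is a Num.int -> ctau k = 1.
Proof. by move=> ik; rewrite -[k]add0r ctauDint// ctau0. Qed.

Lemma ctau_mul a b : ctau (a + b) + ctau (a - b) = 2 * (ctau a * ctau b).
Proof. rewrite /ctau mulrDl mulrBl cosD cosB; ring. Qed.

Lemma ctau_angle t : 0 <= t -> t <= 2^-1 -> t * (pi *+ 2) \in `[0, pi].
Proof.
move=> t0 t2; have p0 : 0 < pi :> R by exact: pi_gt0.
rewrite in_itv /=; apply/andP; split; first by rewrite mulr_ge0// mulrn_wge0// ltW.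
have : t * (pi *+ 2) <= 2^-1 * (pi *+ 2) by rewrite ler_wpM2r// mulrn_wge0// ltW.
by lra.
Qed.

(** The two bounds keep t at distance at least r from -1, 0 and 1; evenness and the reflection t ->
    1 - t bring it into [0, 1/2], where the cosine decreases. *)
Lemma ctau_le_dist r t : 0 <= r -> r <= `|t| -> `|t| <= 1 - r ->
  ctau t <= ctau r.
Proof.
move=> r0 rt t1.
have -> : ctau t = ctau `|t| by case: (ger0P t) => _; rewrite ?ctauN.
have t0 : 0 <= `|t| by [].
move: `|t| t0 rt t1 => {}t t0 rt t1.
have p0 : 0 < pi :> R by exact: pi_gt0.
have le u v : 0 <= u -> u <= v -> v <= 2^-1 -> ctau v <= ctau u.
  move=> u0 uv v2; have vpi := ctau_angle (le_trans u0 uv) v2.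
  have upi := ctau_angle u0 (le_trans uv v2).
  by rewrite /ctau leNgt ltr_cos// -leNgt ler_wpM2r// mulrn_wge0// ltW.
case: (leP t 2^-1) => t2; first by apply: le.
have -> : ctau t = ctau (1 - t).
  by rewrite -ctauN addrC -(@ctauDint (- t) 1)// intr1.
by apply: le => //; lra.
Qed.

Lemma ctau_lt1 r : 0 < r -> r <= 2^-1 -> ctau r < 1.
Proof.
move=> r0 r2; rewrite -cos0 /ctau.
have p0 : 0 < pi :> R by exact: pi_gt0.
rewrite ltr_cos.
- by rewrite mulr_gt0// mulrn_wgt0.
- by rewrite in_itv /=; apply/andP; split; lra.
- by apply: ctau_angle; lra.
Qed.

Lemma ctau_eq1 t : ctau t = 1 -> t \is a Num.int.
Proof.
move=> t1; have /andP[ft tf] := floor_itv t.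
rewrite intrEfloor; apply/negPn/negP => neq.
set u := t - (Num.floor t)%:~R.
have u0 : 0 < u by rewrite subr_gt0 lt_neqAle neq ft.
have u1 : u < 1 by move: tf; rewrite intrD /u; lra.
have cu : ctau u = 1 by rewrite /u ctauDint// rpredN intr_int.
have au : `|u| = u by rewrite gtr0_norm.
have : ctau u < 1.
  case: (leP u 2^-1) => u2.
  - exact: ctau_lt1.
  - apply: (@le_lt_trans _ _ (ctau (1 - u))).
      by apply: ctau_le_dist; rewrite ?au; lra.
    by apply: ctau_lt1; lra.
by rewrite cu ltxx.
Qed.

Lemma ctau_near1 r : 0 < r ->
  exists2 q : R, 0 < q & forall t, `|t| < q -> 1 - r < ctau t.
Proof.
move=> r0; have p0 : 0 < pi :> R by exact: pi_gt0.
have /cvgrPdist_lt /(_ r r0) := @continuous_cos R 0.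
rewrite near_nbhs => /nbhs_ballP [e /= e0 He].
have p2 : 0 < pi *+ 2 :> R by rewrite mulrn_wgt0.
exists (e / (pi *+ 2)) => [|t tq]; first exact: divr_gt0.
have := He (t * (pi *+ 2)); rewrite /ball /= sub0r normrN => /(_ _).
have -> : `|t * (pi *+ 2)| < e.
  by rewrite normrM (gtr0_norm p2) -ltr_pdivlMr.
move=> /(_ isT); rewrite cos0 ltr_norml => /andP[_]; rewrite /ctau; lra.
Qed.

End CosTau.

(** * Characters of the torus and trigonometric polynomials *)

Section TorusGroup.
Variables (R : realType) (n : nat).
Implicit Types (x y z : 'rV[R]_n) (m : 'rV[int]_n) (S K : set 'rV[R]_n).

Lemma fracv_torus x : torus (fracv x).
Proof.
move=> i; rewrite mxE; have /andP[] := floor_itv (x ord0 i).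
by rewrite intrD => h1 h2; apply/andP; split; lra.
Qed.

Lemma fracv_id x : torus x -> fracv x = x.
Proof.
move=> tx; apply/rowP => i; rewrite mxE.
suff -> : Num.floor (x ord0 i) = 0 by rewrite subr0.
by apply: floor_def; rewrite add0r; exact: tx.
Qed.

Lemma fracv_eq x y :
  (forall i, x ord0 i - y ord0 i \is a Num.int) -> fracv x = fracv y.
Proof.
move=> xy; apply/rowP => i; rewrite !mxE.
have -> : x ord0 i = y ord0 i + (x ord0 i - y ord0 i) by rewrite addrC subrK.
rewrite floorDrz// intrD (floorK (xy i)); lra.
Qed.

Lemma sub_fracv_int x i : x ord0 i - fracv x ord0 i \is a Num.int.
Proof. by rewrite mxE opprB addrC subrK intr_int. Qed.

Lemma fracv_subC x i : fracv x ord0 i - x ord0 i \is a Num.int.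
Proof. by rewrite -opprB rpredN sub_fracv_int. Qed.

(** The vector m stands for the character exp(2 pi i [dot m x]) of the torus; triviality at x is
    expressed as integrality of [dot m x]. *)
Definition dot m x : R := \sum_i (m ord0 i)%:~R * x ord0 i.

Lemma dotDl m m' x : dot (m + m') x = dot m x + dot m' x.
Proof. by rewrite /dot -big_split; apply: eq_bigr => i _; rewrite mxE intrD mulrDl. Qed.

Lemma dotNl m x : dot (- m) x = - dot m x.
Proof. by rewrite /dot -sumrN; apply: eq_bigr => i _; rewrite mxE intrN mulNr. Qed.

Lemma dotBl m m' x : dot (m - m') x = dot m x - dot m' x.
Proof. by rewrite dotDl dotNl. Qed.

Lemma dot0l x : dot 0 x = 0.
Proof. by rewrite /dot big1// => i _; rewrite mxE mul0r. Qed.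

Lemma dotDr m x y : dot m (x + y) = dot m x + dot m y.
Proof. by rewrite /dot -big_split; apply: eq_bigr => i _; rewrite mxE mulrDr. Qed.

Lemma dotBr m x y : dot m (x - y) = dot m x - dot m y.
Proof.
by rewrite dotDr; congr (_ + _); rewrite /dot -sumrN; apply: eq_bigr => i _;
  rewrite mxE mulrN.
Qed.

Lemma dot0r m : dot m 0 = 0.
Proof. by rewrite /dot big1// => i _; rewrite mxE mulr0. Qed.

Lemma dot_delta i x : dot (delta_mx ord0 i) x = x ord0 i.
Proof.
rewrite /dot (bigD1 i)//= big1 ?addr0 => [|j ji]; first by rewrite mxE !eqxx mul1r.
by rewrite mxE (negbTE ji) andbF mul0r.
Qed.

Lemma dot_fracv m x : dot m (fracv x) - dot m x \is a Num.int.
Proof.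
rewrite -dotBr /dot; apply: rpred_sum => i _; apply: rpredM; first exact: intr_int.
by rewrite mxE [X in _ + X]mxE; exact: fracv_subC.
Qed.

Lemma dot_fracv_int m x : (dot m (fracv x) \is a Num.int) = (dot m x \is a Num.int).
Proof. by rewrite -[dot m (fracv x)](subrK (dot m x)) rpredDl// dot_fracv. Qed.

Lemma ctau_dot_fracv m x t : ctau (dot m (fracv x) + t) = ctau (dot m x + t).
Proof.
rewrite -(ctauDint (dot m x + t) (dot_fracv m x)); congr ctau; lra.
Qed.

Lemma subgroupD S x y : torus_subgroup S -> S x -> S y -> S (fracv (x + y)).
Proof.
move=> [_ S0 SB] Sx Sy; have := SB _ _ Sx (SB _ _ S0 Sy).
congr S; apply: fracv_eq => i; rewrite sub0r [X in X - _]mxE [(x + y) _ _]mxE.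
rewrite [(- fracv _) _ _]mxE opprD addrACA subrr add0r -opprD rpredN.
by have := fracv_subC (- y) i; rewrite [(- y) _ _]mxE opprK.
Qed.

Lemma subgroup_perm (s : seq 'rV[R]_n) h : uniq s -> torus_subgroup [set` s] ->
  h \in s -> perm_eq [seq fracv (x - h) | x <- s] s.
Proof.
move=> us [st s0 sB] hs.
have um : uniq [seq fracv (x - h) | x <- s].
  rewrite map_inj_in_uniq// => x y /st tx /st ty /rowP xy.
  rewrite -(fracv_id tx) -(fracv_id ty); apply: fracv_eq => i.
  have -> : x ord0 i - y ord0 i =
     ((x - h) ord0 i - fracv (x - h) ord0 i) - ((y - h) ord0 i - fracv (y - h) ord0 i).
    by rewrite xy !mxE; lra.
  by rewrite rpredB// sub_fracv_int.
apply: uniq_perm => //.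
apply: (uniq_min_size um _ _).2; last by rewrite size_map.
by move=> _ /mapP[x xs ->]; exact: sB.
Qed.

(** Orthogonality of characters in real form, the phase t replacing the sine part. Translation by h
    makes the sum S invariant under shifting t by [dot m h]; the product formula then gives S(t) =
    S(t) [ctau (dot m h)], and this cosine is not 1. *)
Lemma sum_character (s : seq 'rV[R]_n) m h t : uniq s ->
  torus_subgroup [set` s] -> h \in s -> dot m h \isn't a Num.int ->
  \sum_(x <- s) ctau (dot m x + t) = 0.
Proof.
move=> us sg hs mh.
pose S u := \sum_(x <- s) ctau (dot m x + u).
have SB u : S u = S (u - dot m h).
  rewrite /S -(perm_big _ (subgroup_perm us sg hs)) big_map.
  by apply: eq_bigr => x _; rewrite ctau_dot_fracv dotBr; congr ctau; lra.
have : S (t + dot m h) + S (t - dot m h) = 2 * (S t * ctau (dot m h)).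
  rewrite /S -big_split /= mulr_suml mulr_sumr.
  by apply: eq_bigr => x _; rewrite -ctau_mul; congr (ctau _ + ctau _); lra.
rewrite -SB (SB (t + _)) addrK => e.
have : S t * (1 - ctau (dot m h)) = 0 by lra.
move/eqP; rewrite mulf_eq0 => /orP[/eqP//|].
by rewrite subr_eq0 eq_sym => /eqP /ctau_eq1; rewrite (negbTE mh).
Qed.

Definition trig_eval (l : seq (R * 'rV[int]_n)) x :=
  \sum_(p <- l) p.1 * ctau (dot p.2 x).

Lemma trig_mul l l' : exists l'', forall x,
  trig_eval l'' x = trig_eval l x * trig_eval l' x.
Proof.
exists ([seq (p.1 * q.1 / 2, p.2 + q.2) | p <- l, q <- l'] ++
        [seq (p.1 * q.1 / 2, p.2 - q.2) | p <- l, q <- l']) => x.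
rewrite /trig_eval big_cat /= !big_allpairs_dep /= mulr_suml -big_split /=.
apply: eq_bigr => p _; rewrite mulr_sumr -big_split /=.
apply: eq_bigr => q _; have := ctau_mul (dot p.2 x) (dot q.2 x).
by rewrite dotDl dotBl => e; rewrite -mulrDr e; field.
Qed.

Lemma trig_exp l k : exists l', forall x, trig_eval l' x = trig_eval l x ^+ k.
Proof.
elim: k => [|k [l1 IH]].
  by exists [:: (1, 0)] => x; rewrite /trig_eval big_seq1 dot0l ctau0 mulr1.
have [l2 l2E] := trig_mul l l1.
by exists l2 => x; rewrite l2E IH exprS.
Qed.

(** Each term lies in [0, 2] and equals 2 exactly at integers, so high powers concentrate at the
    origin of the torus. *)
Definition cosbump x := \sum_i (1 + ctau (x ord0 i)).

Lemma trig_cosbump : exists l, forall x, trig_eval l x = cosbump x.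
Proof.
exists ([seq (1, 0) | i <- index_enum 'I_n] ++ [seq (1, delta_mx ord0 i) | i <- index_enum 'I_n]).
move=> x; rewrite /trig_eval big_cat /= !big_map /cosbump big_split /=.
congr (_ + _); apply: eq_bigr => i _; first by rewrite dot0l ctau0 mulr1.
by rewrite dot_delta mul1r.
Qed.

Lemma cosbump_ge0 x : 0 <= cosbump x.
Proof. by apply: sumr_ge0 => i _; have := ctau_geN1 (x ord0 i); lra. Qed.

(** Argue frequency by frequency: one that is integral on s is integral on K, so its cosine is 1
    throughout; any other sums to zero over s by orthogonality, whatever the phase. *)
Lemma trig_sum_translate l (s : seq 'rV[R]_n) K y z : uniq s ->
  torus_subgroup [set` s] -> [set` s] `<=` K ->
  (forall p, p \in l -> (forall x, x \in s -> dot p.2 x \is a Num.int) ->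
    forall x, K x -> dot p.2 x \is a Num.int) ->
  K y -> K z ->
  \sum_(x <- s) trig_eval l (x - y) = \sum_(x <- s) trig_eval l (x - z).
Proof.
move=> us sg sK lK Ky Kz; rewrite /trig_eval exchange_big [RHS]exchange_big /=.
rewrite big_seq [RHS]big_seq; apply: eq_bigr => p pl.
rewrite -!mulr_sumr; congr (_ * _).
have [/(lK _ pl) Kp|] := pselect (forall x, x \in s -> dot p.2 x \is a Num.int).
  rewrite big_seq [RHS]big_seq; apply: eq_bigr => x xs.
  by rewrite !ctau_int// dotBr rpredB// Kp//; exact: sK.
move=> /existsNP[h /not_implyP[hs /negP ph]].
under eq_bigr do rewrite dotBr; rewrite (sum_character _ us sg hs ph).
by under eq_bigr do rewrite dotBr; rewrite (sum_character _ us sg hs ph).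
Qed.

End TorusGroup.

(** * Separating finite subgroups from a ball by finitely many characters *)

Lemma sum_seq_const (V : nmodType) (T : Type) (s : seq T) (c : V) :
  \sum_(x <- s) c = c *+ size s.
Proof. by rewrite big_const_seq count_predT iter_addr_0. Qed.

Lemma exp_dominates (R : realType) (a b c : R) : 0 <= a -> a < b ->
  exists N, c * a ^+ N < b ^+ N.
Proof.
move=> a0 ab; have b0 : 0 < b by exact: le_lt_trans ab.
have ab0 : 0 <= a / b by rewrite divr_ge0// ltW.
have q1 : `|a / b| < 1 by rewrite ger0_norm// ltr_pdivrMr// mul1r.
have c1 : 0 < (`|c| + 1)^-1 by rewrite invr_gt0 ltr_wpDl.
have /cvgr0Pnorm_lt /(_ _ c1) [N _ /(_ N (leqnn N)) /=] := cvg_expr q1.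
rewrite normrX ger0_norm// expr_div_n => h; exists N.
have bN : 0 < b ^+ N by exact: exprn_gt0.
have cp : 0 < `|c| + 1 by rewrite ltr_wpDl.
apply: (@le_lt_trans _ _ ((`|c| + 1) * a ^+ N)).
  by rewrite ler_wpM2r ?exprn_ge0//; have := ler_norm c; lra.
by move: h; rewrite ltr_pdivrMr// mulrC ltr_pdivlMr// mulrC.
Qed.

Section Separation.
Variables (R : realType) (n : nat).
Implicit Types (x y : 'rV[R]_n) (m : 'rV[int]_n) (K U : set 'rV[R]_n).

(** Cut the unit cube into q^n boxes of side below r and choose a point of K in each box that meets
    K. The net has to lie in K because averages are translation invariant only along K. *)
Lemma finite_cover K (r : R) : K `<=` @torus R n -> 0 < r ->
  exists ys : seq 'rV[R]_n, [set` ys] `<=` K /\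
    forall x, K x -> exists2 y, y \in ys & forall i, `|x ord0 i - y ord0 i| < r.
Proof.
move=> Kt r0; pose q := (Num.truncn r^-1).+1.
have qr : r^-1 < q%:R by exact: truncnS_gt.
have q0 : 0 < q%:R :> R by rewrite ltr0n.
have trq x i : K x -> (Num.truncn (q%:R * x ord0 i) < q)%N.
  move=> /Kt /(_ i) /andP[x0 x1].
  by rewrite truncn_lt_nat ?mulr_ge0// ?ltW// gtr_pMr.
pose box x : {ffun 'I_n -> 'I_q} := [ffun i => inord (Num.truncn (q%:R * x ord0 i))].
pose pick (b : {ffun 'I_n -> 'I_q}) : option 'rV[R]_n :=
  if pselect (exists x, K x /\ box x = b) is left h then Some (projT1 (cid h)) else None.
have pickP b y : pick b = Some y -> K y /\ box y = b.
  by rewrite /pick; case: pselect => // h [<-]; case: (cid h).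
exists (pmap pick (enum {ffun 'I_n -> 'I_q})); split=> [y|x Kx].
  by rewrite /= mem_pmap => /mapP[b _ /esym /pickP[]].
case e : (pick (box x)) => [y|]; last first.
  by move: e; rewrite /pick; case: pselect => // -[]; exists x.
exists y; first by rewrite mem_pmap; apply/mapP; exists (box x); rewrite ?mem_enum.
have [Ky /ffunP yx] := pickP _ _ e => i.
have /(congr1 (@nat_of_ord _)) := yx i; rewrite !ffunE !inordK ?trq// => te.
have /andP[x0 _] := Kt _ Kx i; have /andP[y0 _] := Kt _ Ky i.
have /andP[] := truncn_itv (mulr_ge0 (ltW q0) x0).
have /andP[] := truncn_itv (mulr_ge0 (ltW q0) y0).
rewrite te -natr1 => h1 h2 h3 h4.
rewrite -(ltr_pM2l q0) -[X in X * `|_|](gtr0_norm q0) -normrM mulrBr.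
apply: (@lt_trans _ _ 1); first by rewrite ltr_norml; apply/andP; split; lra.
by rewrite mulrC -ltr_pdivrMl// mulr1.
Qed.

(** The ball around x0 is measured by cosines, hence on the torus. The list [ms] is fixed before s:
    it consists of the frequencies of one polynomial that are nontrivial on K. *)
Lemma separation K x0 (d : R) : torus_subgroup K -> K x0 -> 0 < d ->
  exists ms : seq 'rV[int]_n,
    (forall m, m \in ms -> exists2 x, K x & dot m x \isn't a Num.int) /\
    forall s : seq 'rV[R]_n, uniq s -> torus_subgroup [set` s] -> [set` s] `<=` K ->
      (forall x, x \in s -> exists i, ctau (x ord0 i - x0 ord0 i) <= 1 - d) ->
      exists2 m, m \in ms & forall x, x \in s -> dot m x \is a Num.int.
Proof.
(* Outside the ball one term of [cosbump (x - x0)] is at most 2 - d, so the sum is at most a; b lies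
   halfway between a and the maximum 2n. *)
move=> sK Kx0 d0; pose a := 2 * n%:R - d; pose b := a + d / 2.
have sum2 : \sum_(i < n) (2 : R) = 2 * n%:R by rewrite sumr_const card_ord mulr_natr.
have far x : (exists i, ctau (x ord0 i - x0 ord0 i) <= 1 - d) -> cosbump (x - x0) <= a.
  move=> [i xi]; rewrite /cosbump (bigD1 i)//= /a -sum2 [X in _ <= X - d](bigD1 i)//=.
  have : \sum_(j < n | j != i) (1 + ctau ((x - x0) ord0 j)) <= \sum_(j < n | j != i) (2 : R).
    by apply: ler_sum => j _; have := ctau_le1 ((x - x0) ord0 j); lra.
  by rewrite [(x - x0) ord0 i]mxE [(- x0) _ _]mxE; lra.
(* For negative a no s can avoid the ball: its element 0 would give a negative value of
   [cosbump]. *)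
case: (ltP a 0) => [an|a0].
  exists [::]; split=> // s us [_ s0 _] _ /(_ _ s0) /far h.
  by have := cosbump_ge0 (0 - x0); lra.
have ab : a < b by rewrite /b; lra.
(* A loss of r in each of n terms totals at most d/2; the denominator n + 1 also covers n = 0. *)
pose r := d / 2 / n.+1%:R.
have r0 : 0 < r by rewrite !divr_gt0.
have [q q0 qP] := ctau_near1 r0.
have near x y : (forall i, `|x ord0 i - y ord0 i| < q) -> b <= cosbump (x - y).
  move=> xy; apply: (@le_trans _ _ (\sum_(i < n) (2 - r))); last first.
    by apply: ler_sum => i _; rewrite !mxE; have := qP _ (xy i); lra.
  rewrite sumrB sum2 sumr_const card_ord -[X in _ - X]mulr_natr /b /a.
  have : r * n%:R <= d / 2.
    by rewrite /r mulrAC ler_pdivrMr// ler_wpM2l ?ler_nat// divr_ge0// ltW.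
  lra.
have [ys [ysK ysP]] := finite_cover (let: And3 h _ _ := sK in h) q0.
(* With this power, a single value near the peak outweighs one far value for every point of the
   net. *)
have [N Nab] := exp_dominates (size ys)%:R a0 ab.
have [l0 l0P] := trig_cosbump R n.
have [l lP] := trig_exp l0 N.
pose g x := cosbump x ^+ N.
have lg x : trig_eval l x = g x by rewrite lP l0P.
have g0 x : 0 <= g x by rewrite exprn_ge0// cosbump_ge0.
exists [seq m <- [seq p.2 | p <- l] | `[< exists2 x, K x & dot m x \isn't a Num.int >]].
split=> [m|s us ss sK' sfar]; first by rewrite mem_filter => /andP[/asboolP].
(* If no listed character is trivial on s, every frequency trivial on s is trivial on K, which is
   what translation invariance requires. *)
apply: contrapT => nm.
have lK p : p \in l -> (forall x, x \in s -> dot p.2 x \is a Num.int) ->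
    forall x, K x -> dot p.2 x \is a Num.int.
  move=> pl ps x Kx; apply: contrapT => /negP px; apply: nm; exists p.2 => //.
  by rewrite mem_filter map_f// andbT; apply/asboolP; exists x.
have tr y : K y -> \sum_(x <- s) g (x - y) = \sum_(x <- s) g (x - x0).
  move=> Ky; have := trig_sum_translate us ss sK' lK Ky Kx0.
  by under eq_bigr do rewrite lg; under [in RHS]eq_bigr do rewrite lg.
have up : \sum_(x <- s) g (x - x0) <= (size s)%:R * a ^+ N.
  rewrite mulr_natl -sum_seq_const big_seq [leRHS]big_seq.
  by apply: ler_sum => x /sfar /far h; rewrite lerXn2r ?nnegrE ?cosbump_ge0.
(* Every x in s has a net point close to it, and that term alone contributes at least b^N. *)
have lo : (size s)%:R * b ^+ N <= \sum_(x <- s) \sum_(y <- ys) g (x - y).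
  rewrite mulr_natl -sum_seq_const big_seq [leRHS]big_seq.
  apply: ler_sum => x /sK' /ysP[y yys xy].
  rewrite (perm_big _ (perm_to_rem yys)) big_cons.
  apply: ler_wpDr; first exact: sumr_ge0.
  by rewrite lerXn2r ?nnegrE ?cosbump_ge0 ?near//; lra.
have : \sum_(x <- s) \sum_(y <- ys) g (x - y) <= (size ys)%:R * ((size s)%:R * a ^+ N).
  rewrite exchange_big /= mulr_natl -sum_seq_const big_seq [leRHS]big_seq.
  by apply: ler_sum => y /ysK /tr ->.
move=> /(le_trans lo); rewrite mulrCA ler_pM2l; first by rewrite leNgt Nab.
by case: ss => _ s0 _; rewrite ltr0n; case: (s) s0.
Qed.

End Separation.

(** * Finite generation of subgroups of Z^n *)

Section IntSubgroups.
Variable n : nat.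
Implicit Types (a b m : 'rV[int]_n) (A B : set 'rV[int]_n).

Definition int_subgroup A := A 0 /\ forall a b, A a -> A b -> A (a - b).

Lemma int_subgroupN A a : int_subgroup A -> A a -> A (- a).
Proof. by move=> [A0 AB] Aa; rewrite -sub0r; exact: AB. Qed.

Lemma int_subgroupD A a b : int_subgroup A -> A a -> A b -> A (a + b).
Proof.
by move=> sA Aa Ab; rewrite -[b]opprK; apply: sA.2 => //; exact: int_subgroupN.
Qed.

Lemma int_subgroupZ A (z : int) a : int_subgroup A -> A a -> A (z *: a).
Proof.
move=> sA Aa; have nat_mul (j : nat) : A (a *+ j).
  elim: j => [|j IH]; first by rewrite mulr0n; exact: sA.1.
  by rewrite mulrS; exact: int_subgroupD.
rewrite -[z]intz scaler_int; case: (intP z) => [|j|j].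
- by rewrite mulr0z; exact: sA.1.
- exact: nat_mul.
- by rewrite mulrNz; apply: int_subgroupN => //; exact: nat_mul.
Qed.

Lemma int_subgroup_fg A : int_subgroup A ->
  exists s : seq 'rV[int]_n, (forall a, a \in s -> A a) /\
    forall B, int_subgroup B -> (forall a, a \in s -> B a) -> A `<=` B.
Proof.
move=> sA.
(* Induction on the number of coordinates not required to vanish: the first of them
   takes its values on A in an ideal of Z, generated by its least nonzero modulus. *)
pose Ak k : set 'rV[int]_n := [set a | A a /\ forall i : 'I_n, (i < k)%N -> a ord0 i = 0].
suff fg j : exists s : seq 'rV[int]_n, (forall a, a \in s -> A a) /\
    forall B, int_subgroup B -> (forall a, a \in s -> B a) -> Ak (n - j)%N `<=` B.
  have [s [sA' sB]] := fg n; exists s; split=> // B /sB h /h hB a Aa.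
  by apply: hB; split=> // i; rewrite subnn.
elim: j => [|j [s [s1 s2]]].
  exists [::]; split=> // B [B0 _] _ a [_ a0].
  suff -> : a = 0 by [].
  by apply/rowP => i; rewrite mxE a0// subn0.
have [jn|nj] := ltnP j n; last first.
  by exists s; split=> // B sB /(s2 _ sB); rewrite (_ : n - j.+1 = n - j)%N//; lia.
have kn : (n - j.+1 < n)%N by lia.
pose i0 := Ordinal kn.
have AkS a : Ak (n - j.+1)%N a -> a ord0 i0 = 0 -> Ak (n - j)%N a.
  move=> [Aa a0] ai; split=> // i; rewrite (_ : n - j = (n - j.+1).+1)%N; last by lia.
  rewrite ltnS leq_eqVlt => /orP[/eqP e|/a0//].
  by rewrite (_ : i = i0)//; apply: val_inj.
(* The shift to d + 1 restricts attention to nonzero leading entries. *)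
pose lead d := `[< exists2 a, Ak (n - j.+1)%N a & `|a ord0 i0|%N = d.+1 >].
have [exd|nd] := pselect (exists d, lead d); last first.
  exists s; split=> // B sB sB' a Aa; apply: (s2 B sB sB'); apply: AkS => //.
  case e : `|a ord0 i0|%N => [|d]; first by apply/eqP; rewrite -absz_eq0 e.
  by exfalso; apply: nd; exists d; apply/asboolP; exists a.
case: (ex_minnP exd) => d /asboolP[a Aa ad] dmin.
exists (a :: s); split=> [b|B sB sB' b Ab].
  by rewrite inE => /predU1P[->|/s1//]; case: Aa.
(* Subtracting z times a leaves the remainder as leading entry, smaller than the least nonzero
   modulus and therefore zero. *)
pose z := (b ord0 i0 %/ a ord0 i0)%Z.
have Ba : B a by apply: sB'; rewrite mem_head.
rewrite -[b](subrK (z *: a)); apply: int_subgroupD => //; last exact: int_subgroupZ.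
have Akba : Ak (n - j.+1)%N (b - z *: a).
  split; first by apply: sA.2; [case: Ab|apply: int_subgroupZ => //; case: Aa].
  by move=> i ik; rewrite !mxE (proj2 Ab)// (proj2 Aa)// mulr0 subr0.
apply: (s2 B sB) => [c cs|]; first by apply: sB'; rewrite inE cs orbT.
apply: AkS => //; apply: contrapT; set w := _ ord0 i0 => /eqP nz.
have a0 : a ord0 i0 != 0 by rewrite -absz_eq0 ad.
have e : w = (b ord0 i0 %% a ord0 i0)%Z by rewrite /w !mxE /modz.
have lt : (`|w| < d.+1)%N.
  by rewrite -ad -ltz_nat !abszE e ger0_norm ?modz_ge0//; exact: ltz_mod.
have wS : `|w|.-1.+1 = `|w|%N by rewrite prednK// lt0n absz_eq0.
have /dmin : lead `|w|.-1%N by apply/asboolP; exists (b - z *: a).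
by rewrite leqNgt -ltnS wS lt.
Qed.

End IntSubgroups.

(** * Noetherian induction on closed subgroups and Lawrence's theorem *)

Section Noetherian.
Variables (R : realType) (n : nat).
Implicit Types (x y : 'rV[R]_n) (m : 'rV[int]_n) (K U : set 'rV[R]_n).

(** This is the preimage in R^n of the kernel of the character; intersecting it with K gives the
    kernel on K. *)
Definition char_ker m : set 'rV[R]_n := [set x | dot m x \is a Num.int].

Lemma dot_continuous m : continuous (dot m : 'rV[R]_n -> R).
Proof.
apply: continuous_big => [|i _ x]; first exact: add_continuous.
by apply: continuousM; [exact: cst_continuous | exact: coord_continuous].
Qed.

Lemma char_ker_closed m : closed (char_ker m).
Proof.
have -> : char_ker m = (fun x => ctau (dot m x)) @^-1` [set t | t = 1].
  by apply/seteqP; split=> x /=; [exact: ctau_int | exact: ctau_eq1].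
apply: preimage_closed; last exact: closed_eq.
move=> x _; apply: (@continuous_comp _ _ _ (fun y => dot m y * (pi *+ 2)) (@cos R)); last exact: continuous_cos.
apply: continuousM; [exact: dot_continuous | exact: cst_continuous].
Qed.

Lemma closed_subgroup_torus : closed_subgroup (@torus R n).
Proof.
split; first split=> //.
- by move=> i; rewrite mxE lexx ltr01.
- by move=> x y _ _; exact: fracv_torus.
rewrite /torus_closed (_ : _ @^-1` _ = setT); first exact: closedT.
by apply/seteqP; split=> // x _; exact: fracv_torus.
Qed.

Lemma closed_subgroupI K K' : closed_subgroup K -> closed_subgroup K' ->
  closed_subgroup (K `&` K').
Proof.
move=> [[tK K0 KB] cK] [[_ K'0 K'B] cK']; split; first split.
- by move=> x [/tK].
- by [].
- by move=> x y [Kx K'x] [Ky K'y]; split; [exact: KB | exact: K'B].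
- exact: closedI.
Qed.

Lemma closed_subgroup_ker K m : closed_subgroup K -> closed_subgroup (K `&` char_ker m).
Proof.
move=> [[tK K0 KB] cK]; split; first split.
- by move=> x [/tK].
- by split => //; rewrite /char_ker /= dot0r rpred0.
- move=> x y [Kx mx] [Ky my]; split; first exact: KB.
  by rewrite /char_ker /= dot_fracv_int dotBr rpredB.
- rewrite /torus_closed preimage_setI; apply: closedI => //.
  rewrite (_ : _ @^-1` _ = char_ker m); first exact: char_ker_closed.
  by apply/seteqP; split=> x; rewrite /char_ker /= dot_fracv_int.
Qed.

(** A counterexample yields, by dependent choice, a chain in which each subgroup is cut by a
    character nontrivial on it. The union of the increasing annihilators is finitely generated, so
    the chain of annihilators stops growing. *)
Lemma closed_subgroup_ind (P : set 'rV[R]_n -> Prop) :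
  (forall K, closed_subgroup K ->
    (forall m x, K x -> dot m x \isn't a Num.int -> P (K `&` char_ker m)) -> P K) ->
  forall K, closed_subgroup K -> P K.
Proof.
move=> step K0 cK0; apply: contrapT => nP.
pose T := {K : set 'rV[R]_n | closed_subgroup K /\ ~ P K}.
pose rel (K K' : T) := exists m, (exists2 x, sval K x & dot m x \isn't a Num.int) /\
  sval K' = sval K `&` char_ker m.
have next (K : T) : {K' : T | rel K K'}.
  apply: cid; case: K => K [cK nK].
  have : ~ (forall m x, K x -> dot m x \isn't a Num.int -> P (K `&` char_ker m)).
    by move=> h; exact: nK (step _ cK h).
  move=> /existsNP[m] /existsNP[x] /not_implyP[Kx] /not_implyP[mx nP'].
  exists (exist _ (K `&` char_ker m) (conj (closed_subgroup_ker m cK) nP')).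
  by exists m; split => //; exists x.
have [f [_ fS]] := dependent_choice next (exist _ K0 (conj cK0 nP)).
pose ann i : set 'rV[int]_n := [set m | sval (f i) `<=` char_ker m].
have annS i j : (i <= j)%N -> ann i `<=` ann j.
  move=> /subnK <-; elim: (j - i)%N => [//|k IH] m /IH.
  by rewrite addSn; case: (fS (k + i)%N) => m' [_ e] h x; rewrite e => -[/h].
have annG i : int_subgroup (ann i).
  split=> [x _|a b ha hb x fx]; rewrite /char_ker /=; first by rewrite dot0l rpred0.
  by rewrite dotBl rpredB//; [exact: ha | exact: hb].
have : int_subgroup (\bigcup_i ann i).
  split; first by exists 0%N => //; exact: (annG 0%N).1.
  move=> a b [i _ ai] [j _ bj]; exists (maxn i j) => //.
  by apply: (annG _).2; [apply: annS ai | apply: annS bj]; rewrite ?leq_maxl ?leq_maxr.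
move=> /int_subgroup_fg[s [sU sB]].
have [N sN] : exists N, forall a, a \in s -> ann N a.
  elim: (s) sU => [|a t IH] h; first by exists 0%N.
  have [N NP] : exists N, forall b, b \in t -> ann N b.
    by apply: IH => b bt; apply: h; rewrite inE bt orbT.
  have [i _ ai] := h a (mem_head _ _).
  exists (maxn i N) => b; rewrite inE => /predU1P[->|/NP].
    by apply: annS ai; exact: leq_maxl.
  by apply: annS; exact: leq_maxr.
(* The character cutting step N annihilates step N + 1, hence already step N, where it was
   nontrivial. *)
have [m [[x fx /negP mx] e]] := fS N.
apply: mx; apply: (sB _ (annG N) sN m _ x fx).
by exists N.+1 => // y; rewrite e => -[].
Qed.

(** If K misses U, it covers everything by itself. Otherwise [separation] sends each G into one of
    finitely many proper kernels in K, and the covers given by induction are concatenated. Confining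
    K to K0 lets fatness be tested inside a single face. *)
Lemma lawrence K0 U :
  (forall K, closed_subgroup K -> K `<=` K0 -> (exists2 x, K x & U x) ->
    exists x0 d, [/\ K x0, 0 < d &
      forall x, K x -> (forall i, 1 - d < ctau (x ord0 i - x0 ord0 i)) -> U x]) ->
  forall K, closed_subgroup K -> K `<=` K0 ->
  exists Ws : seq (set 'rV[R]_n),
    (forall W, W \in Ws -> closed_subgroup W /\ forall x, W x -> ~ U x) /\
    forall G, torus_subgroup G -> finite_set G -> G `<=` K -> (forall x, G x -> ~ U x) ->
      exists2 W, W \in Ws & G `<=` W.
Proof.
move=> fat; apply: (@closed_subgroup_ind (fun K => K `<=` K0 -> _)) => K cK IH KK0.
have [KU|nKU] := pselect (exists2 x, K x & U x); last first.
  exists [:: K]; split=> [W|G _ _ GK _]; last by exists K; rewrite ?mem_head.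
  by rewrite inE => /eqP ->; split => // x Kx Ux; apply: nKU; exists x.
have [x0 [d [Kx0 d0 dU]]] := fat _ cK KK0 KU.
have [ms [msK msP]] := separation cK.1 Kx0 d0.
suff [Ws [WsU WsP]] : exists Ws : seq (set 'rV[R]_n),
    (forall W, W \in Ws -> closed_subgroup W /\ forall x, W x -> ~ U x) /\
    forall m, m \in ms -> forall G, torus_subgroup G -> finite_set G ->
      G `<=` K `&` char_ker m -> (forall x, G x -> ~ U x) ->
      exists2 W, W \in Ws & G `<=` W.
  exists Ws; split => // G sG fG GK GU.
  have [s us Gs] : exists2 s : seq 'rV[R]_n, uniq s & G = [set` s].
    have /finite_seqP[s ->] := fG; exists (undup s); first exact: undup_uniq.
    by apply/seteqP; split=> x /=; rewrite mem_undup.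
  move: sG fG GK GU; rewrite {}Gs => sG fG GK GU.
  have [m mms ms0] : exists2 m, m \in ms & forall x, x \in s -> dot m x \is a Num.int.
    apply: msP => // x xs; apply: contrapT => h; apply: (GU x xs).
    apply: dU => [|i]; first exact: GK.
    by rewrite ltNge; apply/negP => hi; apply: h; exists i.
  by apply: WsP mms _ sG fG _ GU => x xs; split; [exact: GK | exact: ms0].
elim: ms msK {msP} => [_|m ms IHm msK]; first by exists [::].
have [Ws [WsU WsP]] := IHm (fun a h => msK a (mem_behead (s := m :: ms) h)).
have [x Kx mx] := msK m (mem_head _ _).
have [|Vs [VsU VsP]] := IH m x Kx mx; first by move=> y [/KK0].
exists (Vs ++ Ws); split=> [W|b].
  by rewrite mem_cat => /orP[/VsU|/WsU].
rewrite inE => /predU1P[->|bms] G sG fG GK GU.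
  by have [W WVs GW] := VsP G sG fG GK GU; exists W => //; rewrite mem_cat WVs.
by have [W WWs GW] := WsP b bms G sG fG GK GU; exists W => //; rewrite mem_cat WWs orbT.
Qed.

End Noetherian.

(** * Coordinate faces and the fatness of their strata *)

Lemma pos_lower_bound (R : realType) (I : finType) (F : I -> R) :
  (forall i, 0 < F i) -> exists2 r, 0 < r & forall i, r <= F i.
Proof.
move=> F0; suff [r r0 rP] : exists2 r, 0 < r & forall i, i \in enum I -> r <= F i.
  by exists r => // i; apply: rP; rewrite mem_enum.
elim: (enum I) => [|a s [r r0 rP]]; first by exists 1.
exists (Num.min (F a) r); first by rewrite lt_min F0.
by move=> i; rewrite inE ge_min => /predU1P[->|/rP ->]; rewrite ?lexx ?orbT.
Qed.

Section Strata.
Variables (R : realType) (n : nat).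
Implicit Types (x y : 'rV[R]_n) (J : {set 'I_n}) (K W G : set 'rV[R]_n).

Definition face J : set 'rV[R]_n :=
  @torus R n `&` [set x | forall j, j \notin J -> x ord0 j = 0].

Lemma int_itv01 (t : R) : 0 <= t < 1 -> t \is a Num.int -> t = 0.
Proof.
move=> t01 /floorK <-; suff -> : Num.floor t = 0 by [].
by apply: floor_def; rewrite add0r.
Qed.

(** As an intersection of character kernels, the lifted face is visibly closed and stable under
    subtraction. *)
Lemma fracv_face J :
  @fracv R n @^-1` face J = \bigcap_(j in [set j | j \notin J]) char_ker (delta_mx ord0 j).
Proof.
apply/seteqP; split=> x /=.
  move=> [_ xJ] j /= jJ; rewrite /char_ker /= -dot_fracv_int dot_delta.
  by rewrite xJ ?rpred0.
move=> h; split; first exact: fracv_torus.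
move=> j jJ; apply: int_itv01; first exact: fracv_torus.
by rewrite -dot_delta dot_fracv_int; exact: h.
Qed.

Lemma closed_subgroup_face J : closed_subgroup (face J).
Proof.
have cT := closed_subgroup_torus R n.
split; last first.
  by rewrite /torus_closed fracv_face; apply: closed_bigI => j _; exact: char_ker_closed.
split; first by move=> x [].
  by split; [case: cT.1 | move=> j _; rewrite mxE].
move=> x y [tx xJ] [ty yJ].
suff : (@fracv R n @^-1` face J) (x - y) by [].
rewrite fracv_face => j /= jJ.
by rewrite /char_ker /= dotBr !dot_delta xJ// yJ// subr0 rpred0.
Qed.

(** The flag treats both versions at once: [true] is the failure of a sum greater than eps, [false]
    the failure of a sum at least eps. *)
Definition below (c : bool) (eps t : R) := if c then t <= eps else t < eps.

(* Stratifying by the support J is essential: a closed subgroup may meet the union of the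
   strata in a nonempty set without relative interior, but not a single stratum inside
   the corresponding face. *)
Definition stratum c eps J : set 'rV[R]_n :=
  [set x | [/\ face J x, forall j, j \in J -> 0 < x ord0 j &
               below c eps (\sum_i x ord0 i)]].

(** Closeness on the circle permits wrapping around from 0 to 1; coordinates of x inside (0, 1)
    exclude this for small d. The last two bounds keep both y and its reflection in x inside (0, 1)
    on J. *)
Lemma ctau_neighborhood J x (r : R) : 0 < r ->
  (forall j, j \in J -> 0 < x ord0 j < 1) ->
  exists2 d, 0 < d & forall y, torus y ->
    (forall j, 1 - d < ctau (y ord0 j - x ord0 j)) ->
    forall j, j \in J -> [/\ `|y ord0 j - x ord0 j| < r,
      `|y ord0 j - x ord0 j| < x ord0 j & `|y ord0 j - x ord0 j| < 1 - x ord0 j].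
Proof.
move=> r0 xJ.
(* The value 1 off J is a positive placeholder. *)
pose F j := if j \in J then Num.min (x ord0 j) (1 - x ord0 j) else 1.
have [|q q0 qF] := @pos_lower_bound _ _ F.
  move=> j; rewrite /F; case: ifP => // /xJ /andP[h1 h2].
  by rewrite lt_min h1 subr_gt0.
pose p := Num.min r (Num.min q 2^-1).
have p0 : 0 < p by rewrite !lt_min r0 q0 invr_gt0 ltr0n.
have [pr pq p2] : [/\ p <= r, p <= q & p <= 2^-1].
  by rewrite /p !ge_min !lexx !orbT.
exists (1 - ctau p); first by rewrite subr_gt0 ctau_lt1.
move=> y ty yx j jJ; have := qF j; rewrite /F jJ le_min => /andP[qx q1].
have /andP[y0 y1] := ty j.
suff : `|y ord0 j - x ord0 j| < p by split; lra.
rewrite ltNge; apply/negP => ge.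
(* As x is at least p away from 0 and 1, the difference is also at most 1 - p in modulus. *)
have : ctau (y ord0 j - x ord0 j) <= ctau p.
  apply: ctau_le_dist => //; first exact: ltW.
  by rewrite ler_norml; apply/andP; split; lra.
by have := yx j; lra.
Qed.

Lemma stratum_open_point c eps J K x : closed_subgroup K -> K `<=` face J -> K x ->
  (forall j, j \in J -> 0 < x ord0 j) -> \sum_i x ord0 i < eps ->
  exists2 d, 0 < d & forall y, K y ->
    (forall i, 1 - d < ctau (y ord0 i - x ord0 i)) -> stratum c eps J y.
Proof.
move=> cK KJ Kx xJ xe.
have [tx x0] := KJ _ Kx.
pose r := (eps - \sum_i x ord0 i) / n.+1%:R.
have r0 : 0 < r by rewrite divr_gt0// subr_gt0.
have [|d d0 dP] := @ctau_neighborhood J x r r0.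
  by move=> j jJ; rewrite xJ//=; case/andP: (tx j).
exists d => // y Ky yx; have [ty y0] := KJ _ Ky.
have near := dP y ty yx.
split; first exact: KJ.
  by move=> j /near[_ + _]; rewrite ltr_norml => /andP[]; lra.
suff : \sum_i y ord0 i < eps by rewrite /below; case: c => // /ltW.
apply: (@le_lt_trans _ _ (\sum_(i < n) (x ord0 i + r))).
  apply: ler_sum => i _; have [/near[+ _ _]|iJ] := boolP (i \in J).
    by rewrite ltr_norml => /andP[_]; lra.
  by rewrite y0// x0//; lra.
rewrite big_split /= sumr_const card_ord -ltrBrDl.
have -> : eps - \sum_(i < n) x ord0 i = r *+ n.+1.
  by rewrite -[RHS]mulr_natr divfK.
by rewrite mulrS ltrDr.
Qed.

(** Only a point x on the hyperplane where the sum is eps is delicate. Either no nearby point of K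
    exceeds eps, and x is a centre, or one does, and its reflection in x is a point of K with sum
    below eps, around which the condition is open. *)
Lemma stratum_fat c eps J K : closed_subgroup K -> K `<=` face J ->
  (exists2 x, K x & stratum c eps J x) ->
  exists x0 d, [/\ K x0, 0 < d &
    forall x, K x -> (forall i, 1 - d < ctau (x ord0 i - x0 ord0 i)) -> stratum c eps J x].
Proof.
move=> cK KJ [x Kx [fx xJ xe]].
have [xlt|xge] := ltP (\sum_i x ord0 i) eps.
  by have [d d0 dP] := stratum_open_point c cK KJ Kx xJ xlt; exists x, d.
case: c xe => /= xe; last by move: xge; rewrite leNgt xe.
have [tx x0] := KJ _ Kx.
have [|d d0 dP] := @ctau_neighborhood J x 1 ltr01.
  by move=> j jJ; rewrite xJ//=; case/andP: (tx j).
have [[y [Ky yx ylt]]|h] := pselect (exists y, [/\ K y,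
    forall i, 1 - d < ctau (y ord0 i - x ord0 i) & eps < \sum_i y ord0 i]); last first.
  exists x, d; split=> // y Ky yx; split; first exact: KJ.
    have [ty _] := KJ _ Ky => j /(dP y ty yx)[_ + _].
    by rewrite ltr_norml => /andP[]; lra.
  by rewrite /below leNgt; apply/negP => lt; apply: h; exists y.
(* The mirror image of y in x lies on the other side of the hyperplane. *)
have [ty y0] := KJ _ Ky.
have near := dP y ty yx.
pose z := x + (x - y).
have zE i : z ord0 i = x ord0 i + (x ord0 i - y ord0 i) by rewrite !mxE.
have zJ j : j \in J -> 0 < z ord0 j < 1.
  by move=> /near[_ + +]; rewrite zE !ltr_norml => /andP[? ?] /andP[? ?]; apply/andP; split; lra.
have tz : torus z.
  move=> j; have [/zJ/andP[/ltW -> ->]//|jJ] := boolP (j \in J).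
  by rewrite zE x0// y0// subrr addr0 lexx ltr01.
have Kz : K z.
  have := subgroupD cK.1 Kx (let: conj (And3 _ _ KB) _ := cK in KB _ _ Kx Ky).
  congr K; rewrite -[RHS]fracv_id//; apply: fracv_eq => i.
  rewrite zE [(x + _) _ _]mxE.
  have -> (a b e : R) : a + b - (a + e) = b - e by lra.
  by have := fracv_subC (x - y) i; rewrite ![(x - y) _ _]mxE [(- y) _ _]mxE.
have [||e e0 eP] := @stratum_open_point true eps J K z cK KJ Kz.
- by move=> j /zJ/andP[].
- by under eq_bigr do rewrite zE; rewrite !(big_split, sumrN) /=; lra.
by exists z, e.
Qed.

End Strata.

(** * From avoided strata to series *)

Section Series.
Variables (R : realType) (n : nat).
Implicit Types (V W G : set 'rV[R]_n) (c : seq (set 'rV[R]_n * set 'rV[R]_n)).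

(** Such a list is a provisional series: a pair (A, B) will impose that G meets A inside B, and
    properness is arranged later. *)
Definition closed_system c :=
  forall p, p \in c -> closed_subgroup p.1 /\ closed_subgroup p.2.

Definition satisfies c G := forall p, p \in c -> G `&` p.1 `<=` p.2.

(* A condition whose left-hand side contains V is absorbed into V, and a condition which
   holds throughout V is dropped; the others satisfy the properness requirements. *)
Lemma system_series c V : closed_subgroup V -> closed_system c ->
  exists s : tseries R n, series_wf s /\
    forall G, belongs G s <-> G `<=` V /\ satisfies c G.
Proof.
move: {2}(size c) (erefl (size c)) => k; elim: k c V => [|k IH] c V szc cV cc.
  move/size0nil: szc cc => -> _.
  by exists (TSeries V 0 (fun=> V) (fun=> 0) (fun _ _ => V))%N; split=> // G; split=> -[].
have [[p pc Vp]|nVp] := pselect (exists2 p, p \in c & V `<=` p.1).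
  have pm q : (q \in c) = (q \in p :: rem p c) by rewrite (perm_mem (perm_to_rem pc)).
  have [|||s [ws sP]] := IH (rem p c) (V `&` p.2).
  - by rewrite size_rem// szc.
  - by apply: closed_subgroupI => //; exact: (cc p pc).2.
  - by move=> q /mem_rem /cc.
  exists s; split=> // G; rewrite sP; split=> -[GV Gc].
    split=> [x /GV[]//|q]; rewrite pm inE => /predU1P[->|]; last exact: Gc.
    by move=> x [/GV[]].
  split=> [x Gx|q /mem_rem]; last exact: Gc.
  by split; [exact: GV | apply: (Gc p pc); split=> //; apply/Vp/GV].
pose c' := [seq p <- c | `[< ~ (V `&` p.1 `<=` p.2) >]].
pose P i := nth (V, V) c' i.
have c'P i : (i < size c')%N -> P i \in c /\ ~ (V `&` (P i).1 `<=` (P i).2).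
  by move=> /(mem_nth (V, V)); rewrite mem_filter => /andP[/asboolP].
exists (TSeries V (size c') (fun i => V `&` (P i).1) (fun=> 1%N)
  (fun i _ => V `&` (P i).1 `&` (P i).2)); split.
  split=> //= [i /c'P[Pc _]|i j /c'P[Pc nP] _].
    split; first by apply: closed_subgroupI => //; exact: (cc _ Pc).1.
    by split=> [x []//|VP]; apply: nVp; exists (P i) => // x /VP[].
  split; first by do ![apply: closed_subgroupI => //]; [exact: (cc _ Pc).1 | exact: (cc _ Pc).2].
  by split=> [x []//|VP]; apply: nP => x /VP[].
move=> G; split=> -[/= GV Gc]; split=> //.
  move=> p pc x [Gx px]; have [Vp|nVpp] := pselect (V `&` p.1 `<=` p.2).
    by apply: Vp; split=> //; exact: GV.
  have pc' : p \in c' by rewrite mem_filter pc andbT; apply/asboolP.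
  have lt : (index p c' < size c')%N by rewrite index_mem.
  have [|j _ []] := Gc _ lt x; rewrite /P nth_index//.
  by split=> //; split=> //; exact: GV.
move=> i /c'P[Pc _] x [Gx [Vx Px]]; exists 0%N => //.
by split=> //; apply: (Gc _ Pc).
Qed.

Lemma systems_series (cs : seq (seq (set 'rV[R]_n * set 'rV[R]_n))) :
  (forall c, c \in cs -> closed_system c) ->
  exists (N : nat) (ss : nat -> tseries R n),
    (forall k, (k < N)%N -> series_wf (ss k)) /\
    forall G, torus_subgroup G ->
      ((exists2 c, c \in cs & satisfies c G) <-> exists2 k, (k < N)%N & belongs G (ss k)).
Proof.
move=> ccs.
have /choice[F FP] : forall c, exists s : tseries R n, closed_system c ->
    series_wf s /\ forall G, belongs G s <-> G `<=` @torus R n /\ satisfies c G.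
  move=> c.
  have [/(system_series (closed_subgroup_torus R n))[s sP]|nc] := pselect (closed_system c).
    by exists s.
  (* A dummy value, so that a series can be chosen for every c. *)
  by exists (TSeries set0 0 (fun=> set0) (fun=> 0) (fun _ _ => set0))%N.
exists (size cs), (fun k => F (nth [::] cs k)); split=> [k kN|G [tG _ _]].
  by have [] := FP _ (ccs _ (mem_nth [::] kN)).
split=> [[c cin cG]|[k kN]].
  exists (index c cs); rewrite ?index_mem// nth_index//.
  by have [_ ->] := FP _ (ccs _ cin).
have kin := mem_nth [::] kN.
by have [_ ->] := FP _ (ccs _ kin) => -[_ kG]; exists (nth [::] cs k).
Qed.

(** G avoids the stratum of J exactly when the finite subgroup of G in [face J] lies in one of the
    subgroups W given by [lawrence]. Choosing one W for each J distributes the conjunction over J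
    across these alternatives. *)
Lemma avoid_strata_systems b eps (Js : seq {set 'I_n}) :
  exists cs : seq (seq (set 'rV[R]_n * set 'rV[R]_n)),
    (forall c, c \in cs -> closed_system c) /\
    forall G, toric_sing G ->
      ((forall J x, J \in Js -> G x -> ~ stratum b eps J x) <->
       exists2 c, c \in cs & satisfies c G).
Proof.
elim: Js => [|J Js [cs [ccs csP]]].
  exists [:: [::]]; split=> [c|G _]; first by rewrite inE => /eqP ->.
  by split=> // _; exists [::]; rewrite ?mem_head.
have [|//|Ws [WsU WsP]] := @lawrence R n (face J) (stratum b eps J) _ _ (closed_subgroup_face R J).
  by move=> K cK KJ; exact: stratum_fat.
exists [seq (face J, W) :: c | W <- Ws, c <- cs]; split=> [_ /allpairsP[[W c] /= [Win cin ->]]|].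
  move=> p; rewrite inE => /predU1P[->|]; last exact: ccs.
  by split; [exact: closed_subgroup_face | have [] := WsU _ Win].
move=> G sG; split=> [GJ|[_ /allpairsP[[W c] /= [Win cin ->]] Gc] J' x].
  have [GJs _] := csP G sG.
  have [|c cin cG] := GJs; first by move=> J' x J'in; apply: GJ; rewrite inE J'in orbT.
  have [[tG G0 GB] fG _] := sG.
  have [[tF F0 FB] _] := closed_subgroup_face R J.
  have [||||W Win GW] := WsP (G `&` face J).
  - split=> [x [/tG]//||x y [Gx Fx] [Gy Fy]]; first by [].
    by split; [exact: GB | exact: FB].
  - exact: (sub_finite_set (@subIsetl _ _ _) fG).
  - exact: subIsetr.
  - by move=> x [Gx _]; apply: GJ => //; exact: mem_head.
  exists ((face J, W) :: c); first by apply/allpairsP; exists (W, c).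
  by move=> p; rewrite inE => /predU1P[->//|/cG].
rewrite inE => /predU1P[->|J'in] Gx.
  move=> xs; have [_ WU] := WsU _ Win; apply: (WU x) => //.
  by apply: (Gc (face J, W) (mem_head _ _)); split=> //; case: xs.
move: J'in Gx; apply: (csP G sG).2; exists c => // p pc.
by apply: Gc; rewrite inE pc orbT.
Qed.

(** A point belongs to the stratum of its support, and discarding the empty support discards exactly
    the point 0. *)
Lemma avoid_strataP b eps G : toric_sing G ->
  (forall J x, J \in [seq J <- enum {set 'I_n} | J != finset.set0] ->
    G x -> ~ stratum b eps J x) <->
  (forall x, G x -> x <> 0 -> ~ below b eps (\sum_i x ord0 i)).
Proof.
move=> [[tG _ _] _ _]; split=> h.
  move=> x Gx x0 xb; pose J := [set j | x ord0 j != 0]%SET.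
  have JE j : (j \in J) = (x ord0 j != 0) by rewrite inE.
  apply: (h J x) => //.
    rewrite mem_filter mem_enum andbT; apply/eqP => J0; apply: x0.
    by apply/rowP => j; rewrite mxE; apply/eqP/negPn; rewrite -JE J0 inE.
  split=> //; first split; first exact: tG.
    by move=> j; rewrite JE negbK => /eqP.
  by move=> j; rewrite JE lt0r => ->; have /andP[] := tG _ Gx j.
move=> J x; rewrite mem_filter => /andP[/set0Pn[j jJ] _] Gx [_ xJ xb].
apply: (h x Gx _ xb) => x0; have := xJ _ jJ.
by rewrite x0 mxE ltxx.
Qed.

Lemma mld_ge (eps : R) G :
  (eps%:E <= mld G)%E <-> forall x, G x -> x <> 0 -> eps <= \sum_i x ord0 i.
Proof.
split=> [h x Gx x0|h].
  rewrite -lee_fin; apply: (le_trans h); apply: ereal_inf_lbound.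
  by exists x.
by apply: le_ereal_inf_tmp => _ [x [Gx x0] <-]; rewrite lee_fin; exact: h.
Qed.

(** Finiteness turns the pointwise strict bounds into a uniform gap e above eps, so the infimum
    stays strictly above eps, also when it is infinite. *)
Lemma mld_gt (eps : R) G : finite_set G ->
  (eps%:E < mld G)%E <-> forall x, G x -> x <> 0 -> eps < \sum_i x ord0 i.
Proof.
move=> /finite_seqP[s ->]; split=> [h x Gx x0|h].
  rewrite -lte_fin; apply: (lt_le_trans h); apply: ereal_inf_lbound.
  by exists x.
suff [e ee eP] : exists2 e, eps < e &
    forall x, x \in s -> x <> 0 -> e <= \sum_i x ord0 i.
  by apply: (@lt_le_trans _ _ e%:E); [rewrite lte_fin | apply/mld_ge].
elim: s h => [|y s IH] h; first by exists (eps + 1) => //; rewrite ltrDl.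
have [|e ee eP] := IH; first by move=> x xs; apply: h; rewrite /= inE xs orbT.
have [->|/eqP y0] := eqVneq y 0.
  by exists e => // x; rewrite inE => /predU1P[->|/eP].
exists (Num.min e (\sum_i y ord0 i)); first by rewrite lt_min ee h//= mem_head.
move=> x; rewrite inE => /predU1P[->|xs x0]; first by rewrite ge_min lexx orbT.
by rewrite ge_min eP.
Qed.

Lemma avoid_series b eps : exists (N : nat) (ss : nat -> tseries R n),
  (forall k, (k < N)%N -> series_wf (ss k)) /\
  forall G, toric_sing G ->
    ((forall x, G x -> x <> 0 -> ~ below b eps (\sum_i x ord0 i)) <->
     exists2 k, (k < N)%N & belongs G (ss k)).
Proof.
have [cs [ccs csP]] :=
  avoid_strata_systems b eps [seq J <- enum {set 'I_n} | J != finset.set0].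
have [N [ss [ssw ssP]]] := systems_series ccs.
exists N, ss; split=> // G sG; have [tG _ _] := sG.
by rewrite -(ssP G tG) -(csP G sG) avoid_strataP.
Qed.

End Series.

Unset Implicit Arguments.
Set Strict Implicit.

Theorem theorem2p1 (R : realType) (n : nat) (eps : R) :
  (1 <= n)%N -> 0 < eps ->
  (exists (N : nat) (ss : nat -> tseries R n),
     (forall k, (k < N)%N -> series_wf (ss k)) /\
     forall G : set 'rV[R]_n, toric_sing G ->
       ((eps%:E < mld G)%E <-> exists2 k, (k < N)%N & belongs G (ss k))) /\
  (exists (N : nat) (ss : nat -> tseries R n),
     (forall k, (k < N)%N -> series_wf (ss k)) /\
     forall G : set 'rV[R]_n, toric_sing G ->
       ((eps%:E <= mld G)%E <-> exists2 k, (k < N)%N & belongs G (ss k))).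
Proof.
move=> _ _; split.
  have [N [ss [ssw ssP]]] := avoid_series n true eps.
  exists N, ss; split=> // G sG; have [_ fG _] := sG.
  rewrite -(ssP G sG) (mld_gt eps fG).
  by split=> h x Gx x0; have := h x Gx x0; rewrite ltNge => /negP.
have [N [ss [ssw ssP]]] := avoid_series n false eps.
exists N, ss; split=> // G sG; rewrite -(ssP G sG) mld_ge.
by split=> h x Gx x0; have := h x Gx x0; rewrite leNgt => /negP.
Qed.
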